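(* Let $D\colon BU\to\mathbb{R}^m$ satisfy (D1)–(D3) and be of the form $Dx=x(0)-\int_{-\infty}^0[d\nu(s)]\,x(s)$ (as in the context), and let $\widehat D\colon BU\to BU$ be the linear operator $(\widehat Dx)(s)=Dx_s$, $s\le0$. The following statements are equivalent: (i) $D$ is stable. (ii) For each $r>0$ and each sequence $\{x_n\}_{n\in\mathbb{N}}$ in $BU$ such that $\|\widehat Dx_n\|_\infty\le r$ for all $n$ and $\widehat Dx_n\to0$ in the metric $\mathsf{d}$ as $n\to\infty$, one has $x_n(0)\to0$ as $n\to\infty$.
   Context: Notation. $\|\cdot\|$ is the maximum norm on $\mathbb{R}^m$. $X=C((-\infty,0],\mathbb{R}^m)$ carries the compact-open topology, given by the metric $\mathsf{d}(x,y)=\sum_{n\ge1}2^{-n}\frac{\|x-y\|_n}{1+\|x-y\|_n}$, $\|x\|_n=\sup_{s\in[-n,0]}\|x(s)\|$. $BU\subset X$ is the Banach space of bounded uniformly continuous functions with norm $\|x\|_\infty=\sup_{s\le0}\|x(s)\|$, and $B_r=\{x\in BU:\|x\|_\infty\le r\}$. For a continuous $x\colon(-\infty,a]\to\mathbb{R}^m$ and $t\le a$, $x_t\in X$ is defined by $x_t(s)=x(t+s)$, $s\le0$. Hypotheses on $D\colon BU\to\mathbb{R}^m$: (D1) $D$ is linear and continuous for $\|\cdot\|_\infty$. (D2) For each $r>0$, the restriction $D\colon B_r\to\mathbb{R}^m$ is continuous for the compact-open topology on $B_r$. (D3) $D$ is atomic at $0$, i.e. in the representation $Dx=\int_{-\infty}^0[d\mu(s)]x(s)$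 with $\mu=[\mu_{ij}]$ a matrix of real regular Borel measures of finite total variation (which exists by (D1)–(D2)), $\det[\mu_{ij}(\{0\})]\ne0$. It is a standing normalization that $Dx=x(0)-\int_{-\infty}^0[d\nu(s)]\,x(s)$, where $\nu=[\nu_{ij}]_{i,j=1}^m$, each $\nu_{ij}$ is a real regular Borel measure on $(-\infty,0]$ with finite total variation, and $|\nu_{ij}|(\{0\})=0$. Stability: $D$ is stable if there is a continuous $c\colon[0,\infty)\to[0,\infty)$ with $\lim_{t\to\infty}c(t)=0$ such that, for each $\varphi\in BU$ with $D\varphi=0$, the solution $x$ of $Dx_t=0$ for $t\ge0$, $x_0=\varphi$, satisfies $\|x(t)\|\le c(t)\|\varphi\|_\infty$ for each $t\ge0$. (Here a solution is a continuous function $x\colon\mathbb{R}\to\mathbb{R}^m$; it exists and is unique.) *)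

(* Defs.v *)
From HB Require Import structures.
From mathcomp Require Import all_boot all_order all_algebra.
From mathcomp Require Import all_classical all_reals all_analysis.

Set Implicit Arguments.
Unset Strict Implicit.
Unset Printing Implicit Defensive.

Import Order.TTheory GRing.Theory Num.Theory.
Import numFieldNormedType.Exports.

Local Open Scope classical_set_scope.
Local Open Scope ring_scope.

(** * The half-line (-oo, 0] *)

Definition halfline (R : realType) : Type := (`]-oo, (0 : R)]%classic : set R).

HB.instance Definition _ (R : realType) :=
  PseudoMetric.copy (halfline R) (`]-oo, (0 : R)]%classic : set R).

Section halfline.
Variable R : realType.

Definition hl_val (s : halfline R) : R := set_val s.

Lemma hl_val_le0 (s : halfline R) : hl_val s <= 0.
Proof. by have := set_valP s; rewrite /= in_itv. Qed.

Definition hl (s : R) (s0 : s <= 0) : halfline R :=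
  exist _ s (mem_set (s0 : `]-oo, (0 : R)]%classic s)).

Definition hl0 : halfline R := hl (lexx 0).

Lemma hl_addP (s u : halfline R) : hl_val s + hl_val u <= 0.
Proof. by rewrite -[leRHS]addr0 lerD ?hl_val_le0. Qed.

Definition hl_add (s u : halfline R) : halfline R := hl (hl_addP s u).

HB.instance Definition _ := isPointed.Build (halfline R) hl0.

End halfline.

(** * The normed space BU *)

(* The norm of ['cV[R]_m] in the library is the maximum norm. *)
Definition bu_pred (R : realType) (m : nat) : {pred halfline R -> 'cV[R]_m} :=
  fun x => `[< bounded_fun x /\ unif_continuous x >].
Arguments bu_pred : clear implicits.

Section bu_closed.
Variables (R : realType) (m : nat).
Implicit Types x y : halfline R -> 'cV[R]_m.

Lemma bu_predP x : x \in bu_pred R m <->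
  (exists M, forall s, `|x s| <= M) /\
  (forall e : R, 0 < e -> exists2 d : R, 0 < d & forall s u,
     `|hl_val s - hl_val u| < d -> `|x s - x u| < e).
Proof.
rewrite /bu_pred unfold_in; split.
  move=> /asboolP[[M [Mr bM]] /unif_continuousP ux]; split.
    by exists (M + 1) => s; apply: bM => //; rewrite ltrDl.
  move=> e /ux[d d0 dx]; exists d => // s u su.
  by have := dx (s, u) su; rewrite -ball_normE.
move=> [[M bM] ux]; apply/asboolP; split.
  exists M; split; first exact: num_real.
  by move=> N MN s _; exact: le_trans (bM s) (ltW MN).
apply/unif_continuousP => e /ux[d d0 dx].
by exists d => // -[s u] su; rewrite /= -ball_normE; exact: dx.
Qed.

Lemma bu_submod_closed : submod_closed (bu_pred R m).
Proof.
split.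
  apply/bu_predP; split; first by exists 0 => s; rewrite normr0.
  by move=> e e0; exists 1 => // s u _; rewrite subrr normr0.
move=> a x y /bu_predP[[M bM] ux] /bu_predP[[N bN] uy]; apply/bu_predP; split.
  exists (`|a| * M + N) => s; apply: le_trans (ler_normD _ _) _.
  by rewrite normrZ lerD ?ler_wpM2l.
move=> e e0.
have a0 : 0 < `|a| + 1 by rewrite ltr_wpDl.
have e20 : 0 < e / 2 by rewrite divr_gt0.
have [d d0 dx] := ux (e / 2 / (`|a| + 1)) (divr_gt0 e20 a0).
have [c c0 cy] := uy (e / 2) e20.
exists (Num.min d c); first by rewrite lt_min d0.
move=> s u; rewrite lt_min => /andP[/dx xsu /cy ysu].
have -> : (a *: x + y) s - (a *: x + y) u = a *: (x s - x u) + (y s - y u).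
  by rewrite scalerBr opprD addrACA.
apply: le_lt_trans (ler_normD _ _) _; rewrite [ltRHS]splitr.
apply: ler_ltD => //; rewrite normrZ.
rewrite ltr_pdivlMr// in xsu.
by apply: le_trans (ltW xsu); rewrite mulrC ler_wpM2l// lerDl.
Qed.

HB.instance Definition _ := GRing.isSubmodClosed.Build _ _ (bu_pred R m)
  bu_submod_closed.

End bu_closed.

Record BU (R : realType) (m : nat) := MkBU {
  bu_fun :> halfline R -> 'cV[R]_m;
  bu_funP : bu_fun \in bu_pred R m }.

HB.instance Definition _ (R : realType) (m : nat) :=
  [isSub for @bu_fun R m].
HB.instance Definition _ (R : realType) (m : nat) := [Choice of BU R m by <:].
HB.instance Definition _ (R : realType) (m : nat) :=
  [SubChoice_isSubLmodule of BU R m by <:].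

Section bu_norm.
Variables (R : realType) (m : nat).
Implicit Types x y : BU R m.

Definition bu_norm x : R := sup [set `|x s| | s in [set: halfline R]].

Lemma bu_norm_ub x s : `|x s| <= bu_norm x.
Proof.
have /bu_predP[[M bM] _] := bu_funP x.
apply: ub_le_sup; last by exists s.
by exists M => _ [u _ <-].
Qed.

Lemma bu_norm_le x M : (forall s, `|x s| <= M) -> bu_norm x <= M.
Proof.
move=> xM; apply: ge_sup; first by exists `|x (hl0 R)|, (hl0 R).
by move=> _ [s _ <-].
Qed.

Lemma bu_normD x y : bu_norm (x + y) <= bu_norm x + bu_norm y.
Proof.
apply: bu_norm_le => s; apply: le_trans (ler_normD _ _) _.
by rewrite lerD ?bu_norm_ub.
Qed.

Lemma bu_normZ (a : R) x : bu_norm (a *: x) = `|a| * bu_norm x.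
Proof.
have le b y : bu_norm (b *: y) <= `|b| * bu_norm y.
  by apply: bu_norm_le => s; rewrite normrZ ler_wpM2l ?bu_norm_ub.
apply/eqP; rewrite eq_le le/=.
have [->|a0] := eqVneq a 0.
  rewrite normr0 mul0r; apply: le_trans (bu_norm_ub _ (hl0 R)).
  exact: normr_ge0.
rewrite -ler_pdivlMl ?normr_gt0// -normfV.
by apply: le_trans (le _ _); rewrite scalerA mulVf// scale1r.
Qed.

Lemma bu_norm0_eq0 x : bu_norm x = 0 -> x = 0.
Proof.
move=> x0; apply/val_inj/funext => s; apply/eqP.
by rewrite -normr_le0 -x0 bu_norm_ub.
Qed.

HB.instance Definition _ :=
  Lmodule_isNormed.Build R (BU R m) bu_normD bu_normZ bu_norm0_eq0.

Lemma bu_normE x : `|x| = bu_norm x. Proof. by []. Qed.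

End bu_norm.

(** * The metric of the compact-open topology *)

Section compact_open.
Variables (R : realType) (m : nat).
Implicit Types x y : halfline R -> 'cV[R]_m.

Definition seminorm_co (n : nat) x : R :=
  sup [set `|x s| | s in [set s : halfline R | - n%:R <= hl_val s]].

(* The summation index is shifted: the sum starts at n = 1. *)
Definition dist_co x y : R :=
  limn (series (fun n => 2^-1 ^+ n.+1 *
    (seminorm_co n.+1 (x - y) / (1 + seminorm_co n.+1 (x - y))))).

End compact_open.

(** * Regular Borel charges on the half-line *)

Definition borel_halfline (R : realType) :=
  g_sigma_algebraType (@open (halfline R)).

(* Real Borel measures of finite total variation: a charge is finite-valued,
   hence automatically of finite total variation. *)
Notation bcharge R := ({charge set (borel_halfline R) -> \bar R}).

Section charges.
Variable R : realType.
Implicit Types nu : bcharge R.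

(* [charge_pos], [charge_neg] and [total_var] do not depend on the chosen
   Hahn decomposition. *)
Lemma hahn_ex nu : exists PN : set (borel_halfline R) * set (borel_halfline R),
  hahn_decomposition nu PN.1 PN.2.
Proof. by have [P [N h]] := Hahn_decomposition nu; exists (P, N). Qed.

Definition hahnP nu := svalP (cid (hahn_ex nu)).

Definition charge_pos nu := jordan_pos (hahnP nu).
Definition charge_neg nu := jordan_neg (hahnP nu).
Definition total_var nu := charge_variation (hahnP nu).

Definition charge_integral nu (f : halfline R -> R) : R :=
  (\int[charge_pos nu]_s f s - \int[charge_neg nu]_s f s)%R.

Definition regular_charge nu := forall A : set (borel_halfline R),
  measurable A -> forall e : R, 0 < e -> exists K U : set (halfline R),
    [/\ compact K, open U, K `<=` A, A `<=` U &
        (total_var nu (U `\` K) < e%:E)%E].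

End charges.

(* [mx_integral mu x] is the integral of [d mu(s)] x(s) over (-oo, 0]. *)
Definition mx_integral (R : realType) (m : nat) (mu : 'M[bcharge R]_m)
    (x : halfline R -> 'cV[R]_m) : 'cV[R]_m :=
  \col_i \sum_j charge_integral (mu i j) (fun s => x s j 0).

(** * The operator D *)

Section operator.
Variables (R : realType) (m : nat).

Definition co_continuous_on_balls (D : BU R m -> 'cV[R]_m) : Prop :=
  forall r : R, 0 < r -> forall x : BU R m, `|x| <= r ->
  forall e : R, 0 < e -> exists2 d : R, 0 < d &
    forall y : BU R m, `|y| <= r -> dist_co x y < d -> `|D x - D y| < e.

Definition atomic0 (D : BU R m -> 'cV[R]_m) : Prop :=
  exists mu : 'M[bcharge R]_m,
    [/\ forall i j, regular_charge (mu i j),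
        forall x, D x = mx_integral mu x &
        \det (\matrix_(i, j) fine (mu i j [set hl0 R])) != 0].

(* For [x : R -> 'cV[R]_m], [history x t] is x_t. *)
Definition history (x : R -> 'cV[R]_m) (t : R) : halfline R -> 'cV[R]_m :=
  fun s => x (t + hl_val s).

(* The existential says that x_t lies in BU, which always holds when x is
   continuous and x_0 lies in BU, and that [D x_t = 0]. *)
Definition is_solution (D : BU R m -> 'cV[R]_m) (phi : BU R m)
    (x : R -> 'cV[R]_m) : Prop :=
  [/\ continuous x, history x 0 = phi &
      forall t : R, 0 <= t -> exists2 y : BU R m, bu_fun y = history x t & D y = 0].

Definition stable (D : BU R m -> 'cV[R]_m) : Prop :=
  exists c : R -> R,
    [/\ {within `[0, +oo[, continuous c}, forall t : R, 0 <= t -> 0 <= c t,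
        c t @[t --> +oo] --> 0 &
        forall phi : BU R m, D phi = 0 ->
        forall x : R -> 'cV[R]_m, is_solution D phi x ->
        forall t : R, 0 <= t -> `|x t| <= c t * `|phi| ].

Lemma bu_shift_subproof (x : BU R m) (s : halfline R) :
  (fun u => x (hl_add s u)) \in bu_pred R m.
Proof.
have /bu_predP[[M bM] ux] := bu_funP x; apply/bu_predP; split.
  by exists M => u; exact: bM.
move=> e /ux[d d0 dx]; exists d => // u v uv; apply: dx.
by rewrite /hl_add /hl_val /= opprD addrACA subrr add0r.
Qed.

(* [bu_shift x s] is x_s, for s <= 0. *)
Definition bu_shift (x : BU R m) (s : halfline R) : BU R m :=
  MkBU (bu_shift_subproof x s).

Lemma Dhat_subproof (D : {linear BU R m -> 'cV[R]_m}) (cD : continuous D)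
  (x : BU R m) : (fun s => D (bu_shift x s)) \in bu_pred R m.
Proof.
have [k k0 Dk] : exists2 k : R, 0 < k & forall y, `|D y| <= k * `|y|.
  have /linear_boundedP/pinfty_ex_gt0[k k0 Dk] :=
    continuous_linear_bounded 0 (cD 0).
  by exists k.
have /bu_predP[[M bM] ux] := bu_funP x; apply/bu_predP; split.
  exists (k * M) => s; apply: le_trans (Dk _) _; rewrite ler_pM2l//.
  by apply: bu_norm_le => u; exact: bM.
move=> e e0; have e2k : 0 < e / 2 / k by rewrite !divr_gt0.
have [d d0 dx] := ux _ e2k.
exists d => // s u su; rewrite -raddfB; apply: le_lt_trans (Dk _) _.
apply: (@le_lt_trans _ _ (e / 2)); last by rewrite ltr_pdivrMr// ltr_pMr// ltr1n.
rewrite mulrC -ler_pdivlMr//; apply: bu_norm_le => v; apply/ltW/dx.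
by rewrite /hl_add /hl_val /= opprD addrACA subrr addr0.
Qed.

Definition Dhat (D : {linear BU R m -> 'cV[R]_m}) (cD : continuous D)
  (x : BU R m) : BU R m := MkBU (Dhat_subproof cD x).

Lemma Dhat_is_linear (D : {linear BU R m -> 'cV[R]_m}) (cD : continuous D) :
  linear (Dhat cD).
Proof.
move=> a x y; apply/val_inj/funext => s /=.
transitivity (D (a *: bu_shift x s + bu_shift y s)); last by rewrite linearP.
by congr (D _); exact/val_inj.
Qed.

End operator.

(* Main.v *)
(* Write (L z)(s) = int [d nu(u)] z(s + u), so that Dhat = 1 - L.  Since nu has
   no mass at 0, L halves the weight exp(l s) for l large.  On functions that
   vanish on (-oo, -T] the weighted and uniform norms are equivalent, so the
   Neumann series inverts Dhat there, with a bound depending only on T; in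
   particular the homogeneous equation can be solved forward in time.

   (i) => (ii): subtract from x a w supported on [-T-1, 0], with Dhat w equal to
   Dhat x on [-T, 0]. The rest is a homogeneous solution on [-T, 0], whence
   |x(0)| <= c(T) |x| + K_T sup_[-T,0] |Dhat x|.  Fixing T with c(T) <= 1/2
   gives |x| <= K |Dhat x|; letting T grow afterwards gives (ii).

   (ii) => (i): if x is a solution with x_0 = phi, then Dhat x_T vanishes on
   [-T, 0] and is bounded by |Dhat| |phi|.  By contradiction, (ii) is uniform
   on the ball |Dhat y| <= r, hence x(T) -> 0 uniformly in |phi| <= 1. *)

Require Import Defs.
From HB Require Import structures.
From mathcomp Require Import all_boot all_order all_algebra.
From mathcomp Require Import all_classical all_reals all_analysis.
From mathcomp Require Import measurable_realfun.
From mathcomp Require Import lra.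

Set Implicit Arguments.
Unset Strict Implicit.
Unset Printing Implicit Defensive.

Import Order.TTheory GRing.Theory Num.Theory.
Import numFieldNormedType.Exports.

Local Open Scope classical_set_scope.
Local Open Scope ring_scope.

(** * Column vectors under the maximum norm *)

Section max_norm.
Variables (R : realType) (m : nat).

Lemma cv_norm_le (v : 'cV[R]_m) (M : R) :
  0 <= M -> (forall i, `|v i 0| <= M) -> `|v| <= M.
Proof.
move=> M0 vM; rewrite [leLHS]mx_normrE; apply: bigmax_le => // -[i j] _ /=.
by rewrite ord1.
Qed.

Lemma cv_norm_ge (v : 'cV[R]_m) i : `|v i 0| <= `|v|.
Proof.
rewrite [leRHS]mx_normrE.
exact: (le_bigmax _ (fun k => `|v k.1 k.2|) (i, 0)).
Qed.

End max_norm.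

(** * Exponential weights under finite measures on the half-line *)

Section charge_estimates.
Variable R : realType.
Local Notation HL := (borel_halfline R).

Lemma continuous_hl_val : continuous (@hl_val R : halfline R -> R).
Proof. exact: initial_continuous. Qed.

Lemma continuous_measurable_halfline (f : halfline R -> R) :
  continuous f -> measurable_fun [set: HL] (f : HL -> R).
Proof.
move=> /continuousP cf; apply: (measurability _ (RGenOpens.measurableE R)).
move=> _ [_ [a [b ->] <-]]; rewrite setTI; apply: sub_sigma_algebra.
exact/cf/interval_open.
Qed.

Lemma continuous_expR_halfline (l : R) :
  continuous (fun u : halfline R => expR (l * hl_val u)).
Proof.
move=> u; apply: (@continuous_comp _ _ _ (@hl_val R) (fun r => expR (l * r))).
  exact: continuous_hl_val.
apply: (@continuous_comp _ _ _ (fun r => l * r)); last exact: continuous_expR.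
exact: mulrl_continuous.
Qed.

Lemma measurable_expR_halfline (l : R) :
  measurable_fun [set: HL] (fun u : HL => expR (l * hl_val u)).
Proof.
exact: continuous_measurable_halfline (@continuous_expR_halfline l).
Qed.

Lemma measurable_hl0 : measurable ([set hl0 R] : set HL).
Proof.
rewrite -[X in measurable X]setCK; apply: measurableC; apply: sub_sigma_algebra.
rewrite /= (_ : ~` [set hl0 R] = (@hl_val R) @^-1` `]-oo, 0[%classic).
  by have /continuousP := continuous_hl_val; apply; exact: interval_open.
apply/seteqP; split => [u /= u0|u /=]; rewrite in_itv/=.
  rewrite lt_neqAle hl_val_le0 andbT; apply/eqP => uE; apply: u0.
  exact/val_inj.
by move=> u0 uE; move: u0; rewrite uE ltxx.
Qed.

Lemma expR_halfline_le1 (l : R) (u : halfline R) :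
  0 <= l -> expR (l * hl_val u) <= 1.
Proof. by move=> l0; rewrite -expR0 ler_expR mulr_ge0_le0// hl_val_le0. Qed.

Lemma integrable_expR_halfline
    (mu : {finite_measure set HL -> \bar R}) (l : R) : 0 <= l ->
  mu.-integrable setT (EFin \o (fun u : HL => expR (l * hl_val u))).
Proof.
move=> l0; apply: measurable_bounded_integrable => //.
- by rewrite ltey_eq fin_num_measure.
- exact: measurable_expR_halfline.
- exists 1; split => // M M1 u _ /=.
  by rewrite ger0_norm ?expR_ge0// (le_trans (expR_halfline_le1 _ _))// ltW.
Qed.

(** Dominated convergence with majorant 1: off [hl0] the integrand is a power of
    [expR (hl_val u) < 1], and [hl0] is null. *)
Lemma cvg_Rintegral_expR_halfline (mu : {finite_measure set HL -> \bar R}) :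
  mu [set hl0 R] = 0%E ->
  \int[mu]_u expR (n%:R * hl_val u) @[n --> \oo] --> (0 : R).
Proof.
move=> mu0.
have [|||||_ _] := @dominated_convergence _ _ _ mu setT measurableT
    (fun n u => (expR (n%:R * hl_val u))%:E) (cst 0%E) (cst 1%E).
- by move=> n; apply/measurable_EFinP; exact: measurable_expR_halfline.
- exact: measurable_cst.
- exists [set hl0 R]; split; [exact: measurable_hl0|exact: mu0|].
  move=> u /= /not_implyP[_] nu; apply: contrapT => u0; apply: nu.
  have {}u0 : hl_val u < 0.
    rewrite lt_neqAle hl_val_le0 andbT; apply/eqP => uE; apply: u0.
    exact/val_inj.
  apply: cvg_EFin; first by near=> n.
  have -> : fine \o (fun n => (expR (n%:R * hl_val u))%:E) =
      (fun n => expR (hl_val u) ^+ n).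
    by apply/funext => n /=; rewrite expRM_natl.
  apply: cvg_expr; rewrite ger0_norm ?expR_ge0//.
  by rewrite -expR0 ltr_expR.
- exact: finite_measure_integrable_cst.
- apply: aeW => u n _ /=.
  by rewrite lee_fin ger0_norm ?expR_ge0// expR_halfline_le1.
rewrite integral0 => /fine_cvg; exact.
Unshelve. all: by end_near. Qed.

Lemma Rintegral_expR_halfline_le (mu : {finite_measure set HL -> \bar R})
    (f : halfline R -> R) (l l' C : R) :
  continuous f -> 0 <= l' -> l' <= l -> 0 <= C ->
  (forall u, `|f u| <= C * expR (l * hl_val u)) ->
  `|\int[mu]_u f u| <= C * \int[mu]_u expR (l' * hl_val u).
Proof.
move=> cf l0 ll C0 fC.
have l1 : 0 <= l by exact: le_trans ll.
have mf := continuous_measurable_halfline cf.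
have fC' u : `|f u| <= C * expR (l' * hl_val u).
  apply: le_trans (fC u) _; rewrite ler_wpM2l// ler_expR.
  by rewrite ler_wnM2r// hl_val_le0.
have bf : [bounded f u | u in [set: HL]].
  exists C; split; first exact: num_real.
  move=> M CM u _ /=; apply: le_trans (fC' u) _.
  rewrite (le_trans _ (ltW CM))// -[leRHS]mulr1 ler_wpM2l//.
  exact: expR_halfline_le1.
have muT : (mu setT < +oo)%E by rewrite ltey_eq fin_num_measure.
have intf : mu.-integrable setT (EFin \o (f : HL -> R)).
  exact: measurable_bounded_integrable.
apply: le_trans (le_normr_Rintegral _ intf) _ => //.
rewrite -RintegralZl//; last exact: integrable_expR_halfline.
apply: le_Rintegral => //.
- by apply: integrable_norm.
- have := integrableZl measurableT C (integrable_expR_halfline mu l0).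
  exact.
Qed.

End charge_estimates.

(** * Functions in [BU] and their exponentially small kernel integrals *)

Section BU_facts.
Variables (R : realType) (m : nat).
Implicit Types x y z : BU R m.

Lemma BU_norm_ge x s : `|x s| <= `|x|.
Proof. exact: bu_norm_ub. Qed.

Lemma BU_norm_le x M : (forall s, `|x s| <= M) -> `|x| <= M.
Proof. exact: bu_norm_le. Qed.

Lemma BU_ext x y : (forall s, x s = y s) -> x = y.
Proof. by move=> xy; apply: val_inj; apply/funext. Qed.

Lemma BU_entry_continuous x (j : 'I_m) : continuous (fun s => x s j 0).
Proof.
have /bu_predP[_ ux] := bu_funP x.
move=> s; have ? : Filter (nbhs s) by exact: nbhs_filter.
apply/cvgrPdist_lt => e /ux[d d0 dx].
have /cvgrPdist_lt/(_ d d0) := @continuous_hl_val R s.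
apply: filterS => u /dx; apply: le_lt_trans.
by have := cv_norm_ge (x s - x u) j; rewrite !mxE.
Qed.

End BU_facts.

(** Both Jordan parts are null at 0, and each gets half of [e]. The rate [n] depends on [nu] and [e]
    only, so it serves all [f] and [C]. *)
Lemma charge_integral_decay (R : realType) (nu : bcharge R) (e : R) :
  total_var nu [set hl0 R] = 0%E -> 0 < e ->
  \forall n \near \oo, forall (f : halfline R -> R) (C : R), continuous f ->
    0 <= C -> (forall u, `|f u| <= C * expR (n%:R * hl_val u)) ->
    `|charge_integral nu f| <= C * e.
Proof.
move=> /eqP; rewrite padde_eq0// => /andP[/eqP pos0 /eqP neg0] e0.
have e20 : 0 < e / 2 by rewrite divr_gt0.
have := @cvg_Rintegral_expR_halfline _ (charge_pos nu) pos0.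
move=> /cvgr0Pnorm_lt/(_ _ e20) pe.
have := @cvg_Rintegral_expR_halfline _ (charge_neg nu) neg0.
move=> /cvgr0Pnorm_lt/(_ _ e20) ne.
near=> n => f C cf C0 fC; rewrite /charge_integral.
apply: le_trans (ler_normB _ _) _; rewrite [e]splitr mulrDr lerD//.
- apply: le_trans
    (Rintegral_expR_halfline_le _ cf (ler0n _ n) (lexx _) C0 fC) _.
  rewrite ler_wpM2l//; apply: le_trans (ler_norm _) _; apply: ltW.
  by near: n.
- apply: le_trans
    (Rintegral_expR_halfline_le _ cf (ler0n _ n) (lexx _) C0 fC) _.
  rewrite ler_wpM2l//; apply: le_trans (ler_norm _) _; apply: ltW.
  by near: n.
Unshelve. all: by end_near. Qed.

(** Finitely many entries share one rate. The factor 1/2 becomes the ratio of the Neumann series. *)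
Lemma mx_integral_decay (R : realType) (m : nat) (nu : 'M[bcharge R]_m) :
  (forall i j, total_var (nu i j) [set hl0 R] = 0%E) ->
  exists2 l : R, 0 <= l & forall (z : BU R m) (C : R), 0 <= C ->
    (forall u, `|z u| <= C * expR (l * hl_val u)) ->
    `|mx_integral nu z| <= C / 2.
Proof.
move=> nu0.
(* Each of the [m] summands of a row gets this share of [C]; [m.+1] avoids dividing by zero when [m]
   is 0. *)
have e0 : 0 < (2 * m.+1%:R : R)^-1 by rewrite invr_gt0 mulr_gt0.
have : \forall n \near \oo, forall i j : 'I_m,
    forall (f : halfline R -> R) (C : R), continuous f ->
    0 <= C -> (forall u, `|f u| <= C * expR (n%:R * hl_val u)) ->
    `|charge_integral (nu i j) f| <= C * (2 * m.+1%:R)^-1.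
  apply: filter_forall => i; apply: filter_forall => j.
  exact: charge_integral_decay.
move=> [N _ /(_ N (leqnn N)) HN]; exists N%:R => // z C C0 zC.
apply: cv_norm_le => [|i]; first by rewrite divr_ge0.
rewrite mxE; apply: le_trans (ler_norm_sum _ _ _) _.
apply: (@le_trans _ _ (\sum_(j < m) C * (2 * m.+1%:R)^-1)).
  apply: ler_sum => j _; apply: HN => // [|u].
    exact: BU_entry_continuous.
  exact: le_trans (cv_norm_ge _ _) (zC u).
rewrite sumr_const card_ord -[leLHS]mulr_natr -[leLHS]mulrA ler_wpM2l//.
by rewrite invfM -mulrA ler_piMr// ler_pdivrMl// mulr1 ler_nat.
Qed.

(** * Lipschitz truncations and clamping to the half-line *)

Section lipschitz_lattice.
Variable R : realType.
Implicit Types a b c : R.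

Lemma min_lip c a b : `|Num.min a c - Num.min b c| <= `|a - b|.
Proof.
wlog ab : a b / a <= b.
  by move=> H; have [/H//|/ltW/H] := leP a b; rewrite distrC (distrC b).
rewrite distrC (distrC a) !ger0_norm ?subr_ge0//; last exact: le_min2.
by case: (leP a c); case: (leP b c); lra.
Qed.

Lemma max_lip c a b : `|Num.max a c - Num.max b c| <= `|a - b|.
Proof.
wlog ab : a b / a <= b.
  by move=> H; have [/H//|/ltW/H] := leP a b; rewrite distrC (distrC b).
rewrite distrC (distrC a) !ger0_norm ?subr_ge0//; last exact: le_max2.
by case: (leP a c); case: (leP b c); lra.
Qed.

End lipschitz_lattice.

Section halfline_cap.
Variable R : realType.
Implicit Types (t : R) (s : halfline R).

Lemma hlcap_subproof t : Num.min t 0 <= 0.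
Proof. by rewrite ge_min lexx orbT. Qed.

(** Clamping at 0 makes translation by any real total, so that times carry no proof of
    nonpositivity. *)
Definition hlcap t : halfline R := hl (hlcap_subproof t).

Lemma hlcapE t : t <= 0 -> hl_val (hlcap t) = t.
Proof. exact: min_l. Qed.

Lemma hlcap0 t : 0 <= t -> hlcap t = hl0 R.
Proof. by move=> t0; apply: val_inj; exact: min_r. Qed.

Lemma hlcapK s : hlcap (hl_val s) = s.
Proof. by apply: val_inj; apply: hlcapE; exact: hl_val_le0. Qed.

Lemma hlcap_lip t u : `|hl_val (hlcap t) - hl_val (hlcap u)| <= `|t - u|.
Proof. exact: min_lip. Qed.

Lemma hl_add_cap s u : hl_add s u = hlcap (hl_val s + hl_val u).
Proof. by apply: val_inj; rewrite /= min_l// hl_addP. Qed.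

End halfline_cap.

(** * Building elements of [BU], and completeness *)

Section BU_constructions.
Variables (R : realType) (m : nat).
Implicit Types x y z : BU R m.

(** Such substitutions translate in time, or freeze a function to the left of a given time. *)
Lemma BU_precomp_subproof x (th : halfline R -> halfline R) :
  (forall s u, `|hl_val (th s) - hl_val (th u)| <= `|hl_val s - hl_val u|) ->
  (fun s => x (th s)) \in bu_pred R m.
Proof.
move=> lip; have /bu_predP[[M bM] ux] := bu_funP x.
apply/bu_predP; split; first by exists M => s; exact: bM.
move=> e /ux[d d0 dx]; exists d => // s u su; apply: dx.
exact: le_lt_trans (lip _ _) su.
Qed.

Lemma BU_mul_subproof x (chi : halfline R -> R) :
  (forall s, `|chi s| <= 1) ->
  (forall s u, `|chi s - chi u| <= `|hl_val s - hl_val u|) ->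
  (fun s => chi s *: x s) \in bu_pred R m.
Proof.
move=> chi1 lip; have /bu_predP[_ ux] := bu_funP x.
apply/bu_predP; split.
  exists `|x| => s; rewrite normrZ -[leRHS]mul1r.
  by rewrite ler_pM//; exact: BU_norm_ge.
move=> e e0; have e20 : 0 < e / 2 by rewrite divr_gt0.
have [d d0 dx] := ux _ e20.
have x0 : 0 < `|x| + 1 by rewrite ltr_wpDl.
exists (Num.min d (e / 2 / (`|x| + 1))).
  by rewrite lt_min d0/= divr_gt0.
move=> s u; rewrite lt_min => /andP[/dx xsu].
rewrite ltr_pdivlMr// => su.
have -> : chi s *: x s - chi u *: x u =
    chi s *: (x s - x u) + (chi s - chi u) *: x u.
  by rewrite scalerBr scalerBl addrA subrK.
rewrite [e]splitr; apply: le_lt_trans (ler_normD _ _) _; rewrite !normrZ.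
apply: ltr_leD.
  by apply: le_lt_trans xsu; rewrite ler_piMl.
apply: le_trans (ltW su); apply: ler_pM => //.
by apply: le_trans (BU_norm_ge _ _) _; rewrite lerDl.
Qed.

(** The pointwise limit inherits the prescribed rate [e], which later gives both the equation and
    the norm bound for the Neumann series. *)
Lemma BU_complete (u : nat -> BU R m) (e : nat -> R) :
  e @ \oo --> (0 : R) -> (forall n p, (n <= p)%N -> `|u p - u n| <= e n) ->
  exists l : BU R m, forall n, `|l - u n| <= e n.
Proof.
move=> e0 ue.
have uep n p s : (n <= p)%N -> `|u p s - u n s| <= e n.
  by move=> /ue; apply: le_trans; exact: (BU_norm_ge (u p - u n) s).
have cu s : cvgn (fun p => u p s).
  apply/cauchy_cvgP/cauchy_exP => d d0.
  have /cvgr0Pnorm_lt/(_ d d0)[N _ eN] := e0.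
  exists (u N s); exists N => // p Np; rewrite /= -ball_normE /= distrC.
  apply: le_lt_trans (uep _ _ s Np) _; apply: le_lt_trans (ler_norm _) _.
  exact: eN (leqnn N).
pose l s := limn (fun p => u p s).
have lu n s : `|l s - u n s| <= e n.
  have cn : `|u p s - u n s| @[p --> \oo] --> `|l s - u n s|.
    by apply: cvg_norm; apply: cvgB; [exact: cu|exact: cvg_cst].
  rewrite -(cvg_lim _ cn)//; apply: limr_le; first exact: cvgP cn.
  by exists n => // p /= np; exact: uep.
suff lP : l \in bu_pred R m.
  by exists (MkBU lP) => n; apply: BU_norm_le => s; exact: lu.
apply/bu_predP; split.
  exists (e 0 + `|u 0|) => s; rewrite -[l s](subrK (u 0 s)).
  by apply: le_trans (ler_normD _ _) _; rewrite lerD ?lu ?BU_norm_ge.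
move=> d d0; have d30 : 0 < d / 3 by rewrite divr_gt0.
have /cvgr0Pnorm_lt/(_ _ d30)[N _ /(_ N (leqnn N)) eN] := e0.
have {}eN : e N < d / 3 by apply: le_lt_trans (ler_norm _) _.
have /bu_predP[_ /(_ _ d30)[c c0 cu']] := bu_funP (u N).
exists c => // s v /cu' usv.
have -> : l s - l v = (l s - u N s) + (u N s - u N v) - (l v - u N v).
  by rewrite opprB !subrKA.
apply: le_lt_trans (ler_normB _ _) _.
have := ler_normD (l s - u N s) (u N s - u N v).
have := lu N s; have := lu N v; lra.
Qed.

End BU_constructions.

Lemma le_geometric0 (R : realType) (a b : R) :
  (forall n, a <= b * 2^-1 ^+ n) -> a <= 0.
Proof.
move=> ab; have bn : b * 2^-1 ^+ n @[n --> \oo] --> b * 0.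
  apply: cvgMl_tmp; apply: cvg_expr.
  by rewrite ger0_norm ?invr_ge0// invf_lt1// ltr1n.
rewrite -[leRHS](mulr0 b) -(cvg_lim _ bn)//; apply: limr_ge.
  exact: cvgP bn.
by near=> n.
Unshelve. all: by end_near. Qed.

(** * Causality, translation and local inversion of [Dhat] *)

Section neutral_operator.
Variables (R : realType) (m : nat) (D : {linear BU R m -> 'cV[R]_m}).
Hypothesis D1 : continuous D.
Implicit Types x y z g : BU R m.

Local Notation Dh := (Dhat D1).

HB.instance Definition _ :=
  GRing.isLinear.Build R (BU R m) (BU R m) *:%R Dh (Dhat_is_linear D1).

Lemma DhatB x y : Dh (x - y) = Dh x - Dh y.
Proof. exact: linearB. Qed.

Lemma bu_shift_le x s : `|bu_shift x s| <= `|x|.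
Proof. by apply: BU_norm_le => u; exact: (BU_norm_ge x). Qed.

Lemma bu_shift0 x : bu_shift x (hl0 R) = x.
Proof.
apply: BU_ext => u /=; congr (x _).
by apply: val_inj; rewrite /= add0r.
Qed.

Lemma Dhat_hl0 x : Dh x (hl0 R) = D x.
Proof. by rewrite /= bu_shift0. Qed.

Lemma Dhat_bounded : exists2 k : R, 0 < k & forall x, `|Dh x| <= k * `|x|.
Proof.
have /linear_boundedP/pinfty_ex_gt0[k k0 Dk] :=
  continuous_linear_bounded 0 (@D1 0).
exists k => // x; apply: BU_norm_le => s; apply: le_trans (Dk _) _.
by rewrite ler_pM2l// bu_shift_le.
Qed.

(** Causality: [bu_shift x s] sees only the times up to [s]. *)
Lemma Dhat_local x y s :
  (forall u, hl_val u <= hl_val s -> x u = y u) -> Dh x s = Dh y s.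
Proof.
move=> xy; congr (D _); apply: BU_ext => u /=; apply: xy.
by rewrite gerDl hl_val_le0.
Qed.

Lemma Dhat_shift x s u : Dh (bu_shift x s) u = Dh x (hl_add s u).
Proof.
congr (D _); apply: BU_ext => v /=; congr (x _).
by apply: val_inj; rewrite /= addrA.
Qed.

Lemma bu_shift_hl0 x s : bu_shift x s (hl0 R) = x s.
Proof. by congr (x _); apply: val_inj; rewrite /= addr0. Qed.

Section volterra.
Variable nu : 'M[bcharge R]_m.
Hypothesis nu_atom0 : forall i j, total_var (nu i j) [set hl0 R] = 0%E.
Hypothesis D_form : forall x, D x = x (hl0 R) - mx_integral nu x.

(** Defined through [Dh], so that its values lie in [BU] at once; [volterraE] recovers the
    integral. *)
Let L x := x - Dh x.

Lemma volterraE x s : L x s = mx_integral nu (bu_shift x s).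
Proof.
rewrite /L -[LHS]/(x s - D (bu_shift x s)) D_form bu_shift_hl0 opprB.
by rewrite addrC subrK.
Qed.

Lemma volterra_local x (t : R) :
  (forall u, hl_val u <= t -> x u = 0) -> forall u, hl_val u <= t -> L x u = 0.
Proof.
move=> x0 u ut; rewrite -[LHS]/(x u - Dh x u) x0// (@Dhat_local _ 0).
  by rewrite linear0 -[LHS]/(0 - 0) subrr.
by move=> v vu; rewrite x0// (le_trans vu).
Qed.

(** Translating by [u] multiplies the weight by [expR (l * hl_val u)], so the integral bound applies
    to each translate with [C] rescaled by that factor. *)
Lemma volterra_decay : exists2 l : R, 0 <= l & forall x (C : R), 0 <= C ->
    (forall u, `|x u| <= C * expR (l * hl_val u)) ->
  forall u, `|L x u| <= C * 2^-1 * expR (l * hl_val u).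
Proof.
have [l l0 lP] := mx_integral_decay nu_atom0; exists l => // x C C0 xC u.
rewrite volterraE mulrAC; apply: lP => [|v].
  by rewrite mulr_ge0 ?expR_ge0.
by rewrite -mulrA -expRD -mulrDr; exact: xC.
Qed.

(** The solution sums the iterates of [L] on [g]. Since [g] vanishes up to [-T], its weighted norm
    costs at most a factor [expR (l * T)]; the factor 2 sums the powers of 1/2. *)
Lemma Dhat_solve (T : R) : exists2 k : R, 0 <= k & forall g,
    (forall u, hl_val u <= - T -> g u = 0) ->
  exists z, [/\ Dh z = g, forall u, hl_val u <= - T -> z u = 0 &
                `|z| <= k * `|g|].
Proof.
have [l l0 lP] := volterra_decay.
exists (2 * expR (l * T)); first by rewrite mulr_ge0 ?expR_ge0.
move=> g g0; pose C := `|g| * expR (l * T).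
have C0 : 0 <= C by rewrite mulr_ge0 ?expR_ge0.
pose w n := iter n L g; pose S n := \sum_(i < n) w i.
have h0 n : 0 <= (2^-1 : R) ^+ n by rewrite exprn_ge0 ?invr_ge0.
have w0 n u : hl_val u <= - T -> w n u = 0.
  by elim: n u => [//|n IH] u; apply: volterra_local => v; exact: IH.
have wC n u : `|w n u| <= C * 2^-1 ^+ n * expR (l * hl_val u).
  elim: n u => [|n IH] u; last first.
    by rewrite exprSr mulrA; apply: lP => //; rewrite mulr_ge0.
  rewrite expr0 mulr1 /C -mulrA -expRD -mulrDr.
  have [uT|/ltW uT] := leP (hl_val u) (- T).
    by rewrite /w /= g0// normr0 mulr_ge0 ?expR_ge0.
  apply: le_trans (BU_norm_ge g u) _; rewrite ler_peMr//.
  by rewrite -expR0 ler_expR mulr_ge0// addrC -lerBlDr sub0r.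
have wn n : `|w n| <= C * 2^-1 ^+ n.
  apply: BU_norm_le => u; apply: le_trans (wC n u) _.
  rewrite ler_piMr//; first by rewrite mulr_ge0.
  exact: expR_halfline_le1.
(* [Dh = 1 - L], so the sum telescopes. *)
have DS n : Dh (S n) = g - w n.
  elim: n => [|n IH]; first by rewrite /S big_ord0 linear0 subrr.
  rewrite /S big_ord_recr linearD /= -/(S n) IH /L -/(w n) opprB.
  by rewrite addrA addrAC.
(* Keeping the subtracted term makes the induction on [d] close. *)
have Sd n d : `|S (n + d)%N - S n| <=
    2 * C * 2^-1 ^+ n - 2 * C * 2^-1 ^+ (n + d).
  elim: d => [|d IH]; first by rewrite addn0 !subrr normr0.
  rewrite addnS /S big_ord_recr /= -/(S _) addrAC.
  apply: le_trans (ler_normD _ _) _.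
  apply: le_trans (lerD IH (wn _)) _.
  by rewrite [_ ^+ (n + d).+1]exprSr; lra.
have [|n p np|z zS] := @BU_complete _ _ S (fun n => 2 * C * 2^-1 ^+ n).
- rewrite -[X in _ --> X](mulr0 (2 * C)); apply: cvgMl_tmp; apply: cvg_expr.
  by rewrite ger0_norm ?invr_ge0// invf_lt1// ltr1n.
- rewrite -(subnKC np); apply: le_trans (Sd _ _) _.
  by rewrite gerBl !mulr_ge0.
exists z; split.
- have [k k0 kP] := Dhat_bounded.
  apply/eqP; rewrite -subr_eq0 -normr_le0.
  apply: (@le_geometric0 _ _ (k * (2 * C) + C)) => n.
  have -> : Dh z - g = Dh (z - S n) - w n.
    by rewrite DhatB DS opprB addrA addrAC addrK.
  apply: le_trans (ler_normB _ _) _; rewrite mulrDl lerD//.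
  apply: le_trans (kP _) _.
  by rewrite -mulrA ler_pM2l.
- move=> u uT; apply/eqP; rewrite -normr_le0.
  apply: (@le_geometric0 _ _ (2 * C)) => n; apply: le_trans (zS n).
  have -> : z u = (z - S n) u.
    have Su : S n u = 0.
      elim: n => [|n IH]; first by rewrite /S big_ord0.
      by rewrite /S big_ord_recr -[LHS]/(S n u + w n u) IH w0// addr0.
    by rewrite -[RHS]/(z u - S n u) Su subr0.
  exact: BU_norm_ge.
(* The empty partial sum is 0, so the error bound at index 0 is the norm bound. *)
- have := zS 0%N; rewrite /S big_ord0 subr0 expr0 mulr1 /C => /le_trans; apply.
  by rewrite mulrA mulrAC.
Qed.

(** One unit of time forward: a constant continuation is corrected by solving for its defect, which
    starts at 0 because [D y = 0]. *)
Lemma Dhat_extend y : D y = 0 -> exists y',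
  (forall t, t <= 0 -> y' (hlcap (t - 1)) = y (hlcap t)) /\
  (forall s, - 1 <= hl_val s -> Dh y' s = 0).
Proof.
move=> Dy0; have [k _ /= kP] := Dhat_solve 1.
have lip1 (s u : halfline R) : `|hl_val (hlcap (hl_val s + 1)) -
    hl_val (hlcap (hl_val u + 1))| <= `|hl_val s - hl_val u|.
  by apply: le_trans (hlcap_lip _ _) _; rewrite opprD addrACA subrr addr0.
(* [y] moved back one unit and held at its value at 0 on [[-1, 0]]. *)
pose y0 := MkBU (BU_precomp_subproof y lip1).
have lip2 (s u : halfline R) : `|hl_val (hlcap (Num.max (hl_val s) (- 1))) -
    hl_val (hlcap (Num.max (hl_val u) (-1)))| <= `|hl_val s - hl_val u|.
  apply: le_trans (hlcap_lip _ _) _.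
  exact: max_lip.
(* The defect of [y0] on [[-1, 0]], frozen further left at its value at -1, which is [D y = 0]. *)
pose g := MkBU (BU_precomp_subproof (Dh y0) lip2).
have [|z [zg z0 _]] := kP g.
  move=> u u1; rewrite -Dy0 -Dhat_hl0.
  rewrite -[LHS]/(Dh y0 (hlcap (Num.max (hl_val u) (- 1)))) max_r//.
  congr (D _); apply: BU_ext => v.
  rewrite -[LHS]/(y (hlcap (hl_val (hl_add (hlcap (- 1)) v) + 1))).
  rewrite -[RHS]/(y (hl_add (hl0 R) v)) !hl_add_cap.
  rewrite (@hlcapE _ (- 1)) ?lerN10// hlcapE; last first.
    by rewrite -[leRHS]addr0 lerD ?lerN10 ?hl_val_le0.
  by rewrite addrAC addNr.
exists (y0 - z); split => [t t0|s s1].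
  have t1 : t - 1 <= - 1 by rewrite gerDr.
  rewrite -[LHS]/(y0 _ - z _) z0 ?subr0; last first.
    by rewrite hlcapE// (le_trans t1)// lerN10.
  rewrite /y0 /=; congr (y _); rewrite hlcapE ?subrK//.
  by rewrite (le_trans t1)// lerN10.
rewrite -[LHS]/(Dh (y0 - z) s) DhatB zg.
rewrite -[LHS]/(Dh y0 s - Dh y0 (hlcap (Num.max (hl_val s) (- 1)))).
by rewrite max_l// hlcapK subrr.
Qed.

End volterra.
End neutral_operator.

(** * Solutions of the homogeneous equation on the whole line *)

Section solutions.
Variables (R : realType) (m : nat) (D : {linear BU R m -> 'cV[R]_m}).
Hypothesis D1 : continuous D.
Implicit Types x y z : BU R m.

Local Notation Dh := (Dhat D1).

Lemma bu_shift_cap y (t : R) (u : halfline R) : t <= 0 ->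
  bu_shift y (hlcap t) u = y (hlcap (t + hl_val u)).
Proof. by move=> t0; rewrite /= hl_add_cap hlcapE. Qed.

(** On [[-T, 0]] the equation makes [Dh y] vanish; further left [Dh y] is a translate of [Dh phi].
    The bound is therefore uniform in [T]. *)
Lemma history_Dhat (phi : BU R m) (X : R -> 'cV[R]_m) (T k : R) :
  (forall x, `|Dh x| <= k * `|x|) -> is_solution D phi X -> 0 <= T ->
  exists y, [/\ bu_fun y = history X T, `|Dh y| <= k * `|phi| &
    forall s, - T <= hl_val s -> Dh y s = 0].
Proof.
move=> kP [cX X0 XD] T0; have [y yX Dy0] := XD T T0; exists y.
have k0 : 0 <= k * `|phi| by apply: le_trans (kP phi).
have ys0 s : - T <= hl_val s -> Dh y s = 0.
  rewrite -subr_ge0 opprK addrC => /XD[y' y'X Dy'0].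
  rewrite -Dy'0; congr (D _); apply: BU_ext => u.
  by rewrite y'X /= yX /history /= addrA.
split=> //; apply: BU_norm_le => s.
have [/ys0->|sT] := leP (- T) (hl_val s); first by rewrite normr0.
have Ts : T + hl_val s <= 0 by rewrite -lerBrDl sub0r ltW.
have -> : Dh y s = Dh phi (hlcap (T + hl_val s)).
  congr (D _); apply: BU_ext => u.
  rewrite bu_shift_cap// -X0 -[LHS]/(y (hl_add s u)) yX /history.
  rewrite add0r hlcapE; last by rewrite -[leRHS]addr0 lerD// hl_val_le0.
  by rewrite -addrA.
exact: le_trans (BU_norm_ge _ _) (kP _).
Qed.

Lemma is_solutionZ (phi : BU R m) (X : R -> 'cV[R]_m) (a : R) :
  is_solution D phi X -> is_solution D (a *: phi) (fun t => a *: X t).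
Proof.
move=> [cX X0 XD]; split.
- by move=> t; apply: cvgZl_tmp; exact: cX.
- by rewrite -[RHS]/(fun s => a *: phi s) -X0.
- move=> t /XD[y yX Dy0]; exists (a *: y).
    by rewrite -[LHS]/(fun s => a *: y s) yX.
  by rewrite linearZ_LR Dy0 scaler0.
Qed.

Section existence.
Variable nu : 'M[bcharge R]_m.
Hypothesis nu_atom0 : forall i j, total_var (nu i j) [set hl0 R] = 0%E.
Hypothesis D_form : forall x, D x = x (hl0 R) - mx_integral nu x.

(** Iterated unit extensions agree where they overlap, and glue to a function on the line. *)
Lemma solution_exists y : D y = 0 -> exists X, is_solution D y X.
Proof.
move=> Dy0.
(* Outside the kernel of [D] the condition is vacuous and the witness arbitrary. *)
have /choice[E EP] : forall y, exists y', D y = 0 ->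
    (forall t, t <= 0 -> y' (hlcap (t - 1)) = y (hlcap t)) /\
    (forall s, - 1 <= hl_val s -> Dh y' s = 0).
  move=> z; have [Dz|Dz] := pselect (D z = 0).
    have [z' z'P] := Dhat_extend D1 nu_atom0 D_form Dz.
    by exists z'.
  by exists z.
(* [Y n] is the history at time [n] of the solution to be built. *)
pose Y n := iter n E y.
have DY0 n : D (Y n) = 0.
  elim: n => [//|n /EP[_ EY]]; rewrite -(Dhat_hl0 D1); apply: EY.
  by rewrite /hl_val /= lerN10.
have YS n t : t <= 0 -> Y n.+1 (hlcap (t - 1)) = Y n (hlcap t).
  by move=> t0; have [-> //] := EP _ (DY0 n).
have Yle n p t : (n <= p)%N -> t <= n%:R ->
    Y p (hlcap (t - p%:R)) = Y n (hlcap (t - n%:R)).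
  move=> /subnKC <- tn; elim: (p - n)%N => [|d IH]; first by rewrite addn0.
  have td : t - (n + d)%:R <= 0.
    by rewrite subr_le0 (le_trans tn)// ler_nat leq_addr.
  by rewrite -IH -(YS _ _ td) addnS -natr1 opprD addrA.
have DhY n s : - n%:R <= hl_val s -> Dh (Y n) s = 0.
  elim: n s => [|n IH] s.
    rewrite oppr0 => s0; have -> : s = hl0 R.
      by apply: val_inj; apply/eqP; rewrite eq_le s0 hl_val_le0.
    by rewrite Dhat_hl0.
  have [s1 _|s1 sn] := leP (- 1) (hl_val s).
    by have [_] := EP _ (DY0 n); apply.
  have s10 : hl_val s + 1 <= 0 by rewrite -lerBrDr sub0r ltW.
  rewrite -(IH (hlcap (hl_val s + 1))); last first.
    by rewrite hlcapE// -lerBlDr -opprD natr1.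
  congr (D _); apply: BU_ext => u; rewrite bu_shift_cap//.
  rewrite -YS; last by rewrite -[leRHS]addr0 lerD// hl_val_le0.
  by rewrite /= hl_add_cap addrAC addrK.
pose N (t : R) := Num.bound `|t|.
pose X t := Y (N t) (hlcap (t - (N t)%:R)).
have XE n t : t <= n%:R -> X t = Y n (hlcap (t - n%:R)).
  move=> tn; rewrite /X.
  have tN : t <= (N t)%:R.
    by apply: le_trans (ler_norm t) _; apply/ltW/archi_boundP.
  have [nN|/ltnW nN] := leqP n (N t); first by rewrite (Yle n).
  by rewrite (Yle _ _ _ nN).
exists X; split.
- move=> t; apply/cvgrPdist_lt => e e0.
  (* Large enough that a single [Y n] represents [X] on the unit ball around [t]; its uniform
     continuity then gives continuity of [X] at [t]. *)
  pose n := N (`|t| + 1).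
  have tn : `|t| + 1 < n%:R.
    by apply: le_lt_trans (ler_norm _) _; exact: archi_boundP.
  have /bu_predP[_ /(_ e e0)[d d0 Yd]] := bu_funP (Y n).
  have d1 : 0 < Num.min d 1 by rewrite lt_min d0/=.
  apply/nbhs_ballP; exists (Num.min d 1) => //= u.
  rewrite /ball /= lt_min => /andP[tud tu1].
  have un : u <= n%:R.
    apply: le_trans (ltW tn); rewrite -[u](subKr t) opprB addrC.
    have := ler_norm t; have := ler_norm (u - t); rewrite distrC; lra.
  rewrite !(XE n)//; last by have := ler_norm t; lra.
  apply: Yd; apply: le_lt_trans (hlcap_lip _ _) _.
  by rewrite opprB addrA subrK.
- apply/funext => u; rewrite /history add0r (XE 0%N) ?hl_val_le0//.
  by rewrite subr0 hlcapK.
- move=> t t0; pose n := N t.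
  have tn : t < n%:R.
    by apply: le_lt_trans (ler_norm t) _; exact: archi_boundP.
  have tn0 : t - n%:R <= 0 by rewrite subr_le0 ltW.
  exists (bu_shift (Y n) (hlcap (t - n%:R))).
    apply/funext => u; rewrite bu_shift_cap// /history (XE n) 1?addrAC//.
    by rewrite -[leRHS]addr0 lerD ?hl_val_le0// ltW.
  by apply: DhY; rewrite hlcapE// -[leLHS]add0r lerD.
Qed.

(** Stability speaks of solutions on the whole line, so [y] is extended past 0 and delayed by [T].
    Up to time [T] the equation is the hypothesis on [y], afterwards that of the extension. *)
Lemma solution_through y (T : R) : 0 <= T ->
  (forall s, - T <= hl_val s -> Dh y s = 0) ->
  exists2 X, is_solution D (bu_shift y (hlcap (- T))) X & X T = y (hl0 R).
Proof.
move=> T0 yT; have NT0 : - T <= 0 by rewrite oppr_le0.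
have Dy0 : D y = 0 by rewrite -(Dhat_hl0 D1) yT.
have [X [cX X0 XD]] := solution_exists Dy0.
have XE t : t <= 0 -> X t = y (hlcap t).
  by move=> t0; rewrite -X0 /history add0r hlcapE.
exists (fun t => X (t - T)); last by rewrite subrr XE// hlcap0.
split.
- move=> t; apply: (@continuous_comp _ _ _ (fun t => t - T) X); last exact: cX.
  by apply: cvgB; [exact: cvg_id|exact: cvg_cst].
- apply/funext => u; rewrite bu_shift_cap// /history add0r addrC XE//.
  by rewrite -[leRHS]addr0 lerD ?hl_val_le0.
- move=> t t0; have [Tt|/ltW tT] := leP T t.
    have [|z zX Dz] := XD (t - T); first by rewrite subr_ge0.
    by exists z => //; rewrite zX; apply/funext => u; rewrite /history addrAC.
  have tT0 : t - T <= 0 by rewrite subr_le0.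
  exists (bu_shift y (hlcap (t - T))).
    apply/funext => u; rewrite bu_shift_cap// /history -XE.
      by rewrite addrAC.
    by rewrite -[leRHS]addr0 lerD ?hl_val_le0.
  by apply: yT; rewrite hlcapE// -[leLHS]add0r lerD.
Qed.

End existence.
End solutions.

(** * The compact-open metric against uniform bounds on [[-T, 0]] *)

Section compact_open_metric.
Variables (R : realType) (m : nat).
Implicit Types y : BU R m.

Lemma seminorm_co_ub y N s : - N%:R <= hl_val s -> `|y s| <= seminorm_co N y.
Proof.
move=> sN; apply: ub_le_sup; last by exists s.
by exists `|y| => _ [u _ <-]; exact: BU_norm_ge.
Qed.

Lemma seminorm_co_le y N M :
  (forall s, - N%:R <= hl_val s -> `|y s| <= M) -> seminorm_co N y <= M.
Proof.
move=> yM; apply: ge_sup; last by move=> _ [s /= /yM ? <-].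
by exists `|y (hl0 R)|, (hl0 R) => //=; rewrite /hl_val /= lerNl oppr0.
Qed.

Lemma seminorm_co_ge0 y N : 0 <= seminorm_co N y.
Proof.
apply: le_trans (seminorm_co_ub y (s := hl0 R) _) => //.
by rewrite /hl_val /= lerNl oppr0.
Qed.

Let term y n := 2^-1 ^+ n.+1 *
  (seminorm_co n.+1 y / (1 + seminorm_co n.+1 y)).

Let half_ge0 n : 0 <= (2^-1 : R) ^+ n.
Proof. by rewrite exprn_ge0 ?invr_ge0. Qed.

Lemma dist_co_term_ge0 y n : 0 <= term y n.
Proof. by rewrite mulr_ge0 ?divr_ge0 ?addr_ge0 ?seminorm_co_ge0. Qed.

Lemma dist_co_termP y n M : seminorm_co n.+1 y <= M ->
  term y n <= 2^-1 ^+ n.+1 * M.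
Proof.
move=> yM; rewrite ler_wpM2l//; apply: le_trans yM.
have := seminorm_co_ge0 y n.+1; set s := seminorm_co _ _ => s0.
by rewrite ler_pdivrMr ?ltr_wpDr// mulrDr mulr1 lerDl mulr_ge0.
Qed.

Lemma dist_co_term_le y n : term y n <= 2^-1 ^+ n.+1.
Proof.
rewrite ler_piMr//; have := seminorm_co_ge0 y n.+1.
set s := seminorm_co _ _ => s0.
by rewrite ler_pdivrMr ?ltr_wpDr// mul1r lerDr.
Qed.

Let nd_series y : nondecreasing_seq (series (term y)).
Proof. by apply: nondecreasing_series => n _ _; exact: dist_co_term_ge0. Qed.

(** The terms that see only [[-N, 0]] add up to at most [M], the others to at most [2^-N]. Stated
    for partial sums, the bound also yields convergence. *)
Lemma series_dist_co_le y N M n : 0 <= M ->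
  (forall s, - N%:R <= hl_val s -> `|y s| <= M) ->
  series (term y) n <= M + 2^-1 ^+ N.
Proof.
move=> M0 yM.
have yM' k : (k <= N)%N -> seminorm_co k y <= M.
  move=> kN; apply: seminorm_co_le => s sk; apply: yM.
  by apply: le_trans sk; rewrite lerN2 ler_nat.
have head k : (k <= N)%N -> series (term y) k <= (1 - 2^-1 ^+ k) * M.
  elim: k => [|k IH] kN.
    by rewrite /series /= big_geq// expr0 subrr mul0r.
  rewrite seriesSr.
  apply: le_trans (lerD (IH (ltnW kN)) (dist_co_termP (yM' _ kN))) _.
  by rewrite exprS; lra.
have tail k : series (term y) (N + k)%N <= M + 2^-1 ^+ N - 2^-1 ^+ (N + k).
  elim: k => [|k IH].
    rewrite addn0 addrK; apply: le_trans (head _ (leqnn N)) _.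
    by rewrite ler_piMl// gerBl.
  rewrite addnS seriesSr; apply: le_trans (lerD IH (dist_co_term_le _ _)) _.
  by rewrite [_ ^+ (N + k).+1]exprS; lra.
apply: le_trans (nd_series y (leq_addl N n)) _; apply: le_trans (tail n) _.
by rewrite gerBl.
Qed.

Let cvg_series y : cvgn (series (term y)).
Proof.
apply: nondecreasing_is_cvgn => //; exists (`|y| + 2^-1 ^+ 0) => _ [n _ <-].
by apply: series_dist_co_le => // s _; exact: BU_norm_ge.
Qed.

Lemma dist_co0E y : dist_co y 0 = limn (series (term y)).
Proof. by rewrite /dist_co subr0. Qed.

Lemma dist_co0_le y N M : 0 <= M ->
  (forall s, - N%:R <= hl_val s -> `|y s| <= M) ->
  dist_co y 0 <= M + 2^-1 ^+ N.
Proof.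
move=> M0 yM; rewrite dist_co0E; apply: limr_le => //.
by near=> n; exact: series_dist_co_le.
Unshelve. all: by end_near. Qed.

Lemma dist_co0_ge y n : term y n <= dist_co y 0.
Proof.
rewrite dist_co0E.
apply: le_trans (nondecreasing_cvgn_le (@nd_series y) _ n.+1) => //.
rewrite seriesSr lerDr -[leLHS](_ : series (term y) 0 = _).
  exact: nd_series.
by rewrite /series /= big_geq.
Qed.

Lemma dist_co0_ge0 y : 0 <= dist_co y 0.
Proof. exact: le_trans (dist_co_term_ge0 y 0) (dist_co0_ge y 0). Qed.

(** A single term of large index controls [[-T, 0]], since [q / (1 + q)] is increasing for
    [q >= 0]. *)
Lemma dist_co0_cvg (y : nat -> BU R m) :
  dist_co (y n) 0 @[n --> \oo] --> (0 : R) ->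
  forall (T e : R), 0 < e ->
  \forall n \near \oo, forall s, - T <= hl_val s -> `|y n s| <= e.
Proof.
move=> y0 T e e0; pose N := Num.bound `|T|.
have TN : T <= N.+1%:R.
  apply: le_trans (ler_norm T) _.
  apply: le_trans (ltW (archi_boundP _)) _ => //.
  by rewrite ler_nat.
(* The value of the term of index [N] when its seminorm, taken over [[-(N + 1), 0]], equals [e]. *)
have d0 : 0 < 2^-1 ^+ N.+1 * (e / (1 + e)).
  by rewrite mulr_gt0 ?exprn_gt0 ?invr_gt0// divr_gt0// addr_gt0.
have /cvgr0Pnorm_lt/(_ _ d0) := y0.
apply: filterS => n /(le_lt_trans (ler_norm _))/(le_lt_trans (dist_co0_ge _ N)).
rewrite /term ltr_pM2l ?exprn_gt0 ?invr_gt0// => yn s sT.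
have /(@seminorm_co_ub (y n))/le_trans : - N.+1%:R <= hl_val s.
  by apply: le_trans sT; rewrite lerN2.
apply.
move: yn; have := seminorm_co_ge0 (y n) N.+1; set q := seminorm_co _ _ => q0.
by rewrite ltr_pdivrMr ?ltr_wpDr// mulrAC ltr_pdivlMr ?addr_gt0//; nra.
Qed.

End compact_open_metric.

Section stability.
Variables (R : realType) (m : nat) (D : {linear BU R m -> 'cV[R]_m}).
Hypothesis D1 : continuous D.
Variable nu : 'M[bcharge R]_m.
Hypothesis nu_atom0 : forall i j, total_var (nu i j) [set hl0 R] = 0%E.
Hypothesis D_form : forall x : BU R m, D x = x (hl0 R) - mx_integral nu x.
Implicit Types x y z : BU R m.

Local Notation Dh := (Dhat D1).

Definition sequential_inverse_continuity : Prop :=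
  forall r : R, 0 < r -> forall x : nat -> BU R m,
    (forall n, `|Dh (x n)| <= r) ->
    dist_co (Dh (x n)) 0 @[n --> \oo] --> (0 : R) ->
    x n (hl0 R) @[n --> \oo] --> (0 : 'cV[R]_m).

(** * Stability implies the sequential condition (ii) *)

Section from_stable.
Variable c : R -> R.
Hypothesis c_ge0 : forall t, 0 <= t -> 0 <= c t.
Hypothesis c_bound : forall phi : BU R m, D phi = 0 ->
  forall X : R -> 'cV[R]_m, is_solution D phi X ->
  forall t : R, 0 <= t -> `|X t| <= c t * `|phi|.

(** [K] depends on [T] but not on [x] or [d]: once [T] is fixed, smallness of [Dh x] on [[-T, 0]]
    alone makes the second term small. *)
Lemma stable_estimate (T : R) : 0 <= T -> exists2 K : R, 0 <= K &
  forall x (d : R), (forall s, - T <= hl_val s -> `|Dh x s| <= d) ->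
    `|x (hl0 R)| <= c T * `|x| + K * d.
Proof.
move=> T0; have [k k0 kP] := Dhat_solve D1 nu_atom0 D_form (T + 1).
(* [k * d] bounds [w] at 0, and [c T * k * d] its share in the initial history of [x - w]. *)
exists (k + c T * k); first by rewrite addr_ge0 ?mulr_ge0 ?c_ge0.
move=> x d xd.
have NT0 : - T <= 0 by rewrite oppr_le0.
have lip1 (s u : halfline R) : `|hl_val (hlcap (Num.max (hl_val s) (- T))) -
    hl_val (hlcap (Num.max (hl_val u) (- T)))| <= `|hl_val s - hl_val u|.
  apply: le_trans (hlcap_lip _ _) _; exact: max_lip.
(* Freezing to the left of [-T] keeps the bound [d] valid on the whole half-line. *)
pose h := MkBU (BU_precomp_subproof (Dh x) lip1).
(* A cutoff of slope one, equal to 1 on [[-T, 0]] and to 0 up to [-T - 1]. *)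
pose chi (s : halfline R) := Num.max (Num.min (hl_val s + (T + 1)) 1) 0.
have chi1 s : `|chi s| <= 1.
  rewrite ger0_norm ?le_max ?lexx ?orbT// ge_max ler01 andbT.
  by rewrite ge_min lexx orbT.
have lip2 s u : `|chi s - chi u| <= `|hl_val s - hl_val u|.
  apply: le_trans (max_lip _ _ _) _; apply: le_trans (min_lip _ _ _) _.
  by rewrite opprD addrACA subrr addr0.
pose g := MkBU (BU_mul_subproof h chi1 lip2).
have gE s : g s = chi s *: Dh x (hlcap (Num.max (hl_val s) (- T))) by [].
have gd : `|g| <= d.
  apply: BU_norm_le => s; rewrite gE normrZ -[leRHS]mul1r ler_pM//; apply: xd.
  by rewrite hlcapE ?le_max ?lexx ?orbT// ge_max hl_val_le0.
have [|w [wg w0 wk]] := kP g.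
  move=> u uT; rewrite gE /chi max_r ?scale0r// ge_min.
  by rewrite -lerBrDr sub0r uT.
have {}wk : `|w| <= k * d by apply: le_trans wk _; rewrite ler_wpM2l.
have yT s : - T <= hl_val s -> Dh (x - w) s = 0.
  move=> sT; rewrite DhatB wg -[LHS]/(Dh x s - g s) gE max_l// hlcapK /chi.
  rewrite min_r; last by rewrite addrA lerDr -lerBlDr sub0r.
  by rewrite max_l// scale1r subrr.
have [X solX XT] := solution_through nu_atom0 D_form T0 yT.
have : `|X T| <= c T * `|bu_shift (x - w) (hlcap (- T))|.
  apply: c_bound solX _ T0.
  by rewrite -[LHS]/(Dh (x - w) (hlcap (- T))) yT// hlcapE.
rewrite XT => yc.
have {}yc : `|(x - w) (hl0 R)| <= c T * (`|x| + `|w|).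
  apply: le_trans yc _; rewrite ler_wpM2l ?c_ge0//.
  exact: le_trans (bu_shift_le _ _) (ler_normB _ _).
have -> : x (hl0 R) = (x - w) (hl0 R) + w (hl0 R) by exact/esym/subrK.
apply: le_trans (ler_normD _ _) _; apply: le_trans (lerD yc (BU_norm_ge w _)) _.
have := ler_wpM2l (c_ge0 T0) wk; lra.
Qed.

Hypothesis c_cvg0 : c t @[t --> +oo] --> 0.

Lemma stable_small (e : R) : 0 < e -> exists2 T, 0 <= T & c T <= e.
Proof.
move=> e0; have /cvgr0Pnorm_lt/(_ _ e0) := c_cvg0.
case=> M [_ HM]; exists (`|M| + 1); first by rewrite addr_ge0.
apply: le_trans (ler_norm _) _; apply/ltW/HM.
by apply: le_lt_trans (ler_norm M) _; rewrite ltrDl.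
Qed.

(** [Dh] commutes with translation, so the estimate holds at every [x s]; with [c T <= 1/2] the term
    in the norm of [x] is absorbed. *)
Lemma stable_Dhat_inverse : exists2 K : R, 0 <= K &
  forall x, `|x| <= K * `|Dh x|.
Proof.
have [T T0 cT] := @stable_small 2^-1 (ltac:(by rewrite invr_gt0)).
have [K K0 KP] := stable_estimate T0; exists (2 * K); first by rewrite mulr_ge0.
move=> x; have : `|x| <= 2^-1 * `|x| + K * `|Dh x|.
  apply: BU_norm_le => s; rewrite -bu_shift_hl0.
  apply: le_trans (KP _ `|Dh x| _) _ => [u _|].
    by rewrite Dhat_shift; exact: BU_norm_ge.
  by rewrite lerD2r ler_pM ?c_ge0// bu_shift_le.
lra.
Qed.

Lemma stable_sequential_inverse_continuity : sequential_inverse_continuity.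
Proof.
move=> r r0 x xr x0; have [K K0 KP] := stable_Dhat_inverse.
apply/cvgr0Pnorm_le => e e0.
(* As the norm of [x n] is at most [K * r], this divisor makes the stability term at most [e / 2];
   adding 1 keeps it positive. *)
have B0 : 0 < 2 * (K * r + 1) by rewrite mulr_gt0// ltr_wpDl// mulr_ge0// ltW.
have [T T0 cT] := stable_small (divr_gt0 e0 B0).
have [K' K'0 K'P] := stable_estimate T0.
have d0 : 0 < e / (2 * (K' + 1)) by rewrite divr_gt0// mulr_gt0// ltr_wpDl.
have := dist_co0_cvg x0 T d0; apply: filterS => n /K'P xn.
apply: le_trans xn _; rewrite [e]splitr; apply: lerD.
  apply: (@le_trans _ _ (e / (2 * (K * r + 1)) * (K * r + 1))).
    apply: ler_pM => //; first exact: c_ge0.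
    apply: le_trans (KP _) _.
    apply: (@le_trans _ _ (K * r)); last by rewrite lerDl.
    by rewrite ler_wpM2l.
  by rewrite invfM mulrA mulfVK// lt0r_neq0// ltr_wpDl// mulr_ge0// ltW.
rewrite mulrA ler_pdivrMr; first by nra.
by rewrite mulr_gt0// ltr_wpDl.
Qed.

End from_stable.

(** * The sequential condition (ii) implies stability *)

Section to_stable.
Hypothesis seq_inv : sequential_inverse_continuity.

(** Counterexamples for the window [[-n, 0]] and tolerance [2^-n] would form a sequence
    contradicting (ii). *)
Lemma uniform_inverse_continuity (r e : R) : 0 < r -> 0 < e ->
  exists N : nat, exists2 d : R, 0 < d & forall y, `|Dh y| <= r ->
    (forall s, - N%:R <= hl_val s -> `|Dh y s| <= d) -> `|y (hl0 R)| <= e.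
Proof.
move=> r0 e0; apply: contrapT => noN.
have h0 n : 0 < (2^-1 : R) ^+ n by rewrite exprn_gt0 ?invr_gt0.
have /choice[y yP] : forall n : nat, exists y, [/\ `|Dh y| <= r,
    forall s, - n%:R <= hl_val s -> `|Dh y s| <= 2^-1 ^+ n &
    e < `|y (hl0 R)|].
  move=> n; apply: contrapT => noy; apply: noN; exists n.
  exists (2^-1 ^+ n) => // y yr yd; rewrite leNgt; apply/negP => ey.
  by apply: noy; exists y.
have : y n (hl0 R) @[n --> \oo] --> (0 : 'cV[R]_m).
  apply: (seq_inv r0) => [n|]; first by have [] := yP n.
  (* The tolerance on the window plus the tail of the metric. *)
  have h : (2 * 2^-1 ^+ n : R) @[n --> \oo] --> (0 : R).
    rewrite -[X in _ --> X](mulr0 2); apply: cvgMl_tmp; apply: cvg_expr.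
    by rewrite ger0_norm ?invr_ge0// invf_lt1// ltr1n.
  apply: (squeeze_cvgr _ (cvg_cst 0) h).
  apply: nearW => n; apply/andP; split; first exact: (dist_co0_ge0 (Dh (y n))).
  have [_ yn _] := yP n.
  by have := dist_co0_le (ltW (h0 n)) yn; rewrite mulr_natl mulr2n.
move=> /cvgr0Pnorm_lt/(_ e e0)[N _ /(_ N (leqnn N))/=].
by have [_ _] := yP N; case: ltgtP.
Unshelve. all: by end_near. Qed.

Lemma sequential_inverse_continuity_stable : stable D.
Proof.
have [k k0 kP] := Dhat_bounded D1.
(* For [t >= N] the window [[-N, 0]] lies in [[-t, 0]], where [Dh y] vanishes, so the tolerance is
   met. *)
have small (e : R) : 0 < e -> exists2 T0, 0 <= T0 & forall phi X,
    is_solution D phi X -> `|phi| <= 1 -> forall t, T0 <= t -> `|X t| <= e.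
  move=> e0; have [N [d d0 NP]] := uniform_inverse_continuity k0 e0.
  exists N%:R => // phi X sX phi1 t Nt.
  have t0 : 0 <= t by exact: le_trans Nt.
  have [y [yX yk y0]] := history_Dhat kP sX t0.
  have -> : X t = y (hl0 R) by rewrite yX /history addr0.
  apply: NP => [|s sN].
    by apply: le_trans yk _; rewrite ler_piMr// ltW.
  rewrite y0; first by rewrite normr0 ltW.
  by apply: le_trans sN; rewrite lerN2.
have [M M0 MP] : exists2 M : R, 0 < M & forall phi X,
    is_solution D phi X -> `|phi| <= 1 -> forall t, 0 <= t -> `|X t| <= M.
  have [N [d d0 NP]] := uniform_inverse_continuity ltr01 ltr01.
  (* Dividing the solution by [a] makes [Dh y] at most [d] everywhere, so the window puts no
     restriction on [t]. *)
  pose a := k / Num.min 1 d.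
  have m0 : 0 < Num.min 1 d by rewrite lt_min ltr01.
  have a0 : 0 < a by rewrite divr_gt0.
  have aV : `|a^-1| = a^-1 by rewrite gtr0_norm ?invr_gt0.
  exists a => // phi X sX phi1 t t0.
  have [y [yX yk y0]] := history_Dhat kP (is_solutionZ a^-1 sX) t0.
  have {}yk : `|Dh y| <= Num.min 1 d.
    apply: le_trans yk _; rewrite normrZ aV.
    rewrite /a invf_div mulrA [k * _]mulrC mulfVK ?gt_eqF//.
    by rewrite ler_piMr// ltW.
  have : `|y (hl0 R)| <= 1.
    apply: NP => [|s _].
      by apply: le_trans yk _; rewrite ge_min lexx.
    apply: le_trans (BU_norm_ge _ _) _; apply: le_trans yk _.
    by rewrite ge_min lexx orbT.
  rewrite yX /history addr0 normrZ aV.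
  by rewrite ler_pdivrMl// mulr1.
(* A 1-Lipschitz tent smooths the supremum over all normalized solutions. *)
pose tent (t s : R) := Num.max (1 - `|t - s|) 0.
have tent0 t s : 0 <= tent t s by rewrite le_max lexx orbT.
have tent1 t s : tent t s <= 1 by rewrite ge_max ler01 andbT gerBl.
(* [tent t] is 1 at [t], which gives the majorant, and 0 off [[t - 1, t + 1]], which preserves the
   decay. *)
pose A t := [set v : R | exists phi X s, [/\ is_solution D phi X,
  `|phi| <= 1, 0 <= s & v = `|X s| * tent t s]].
pose c t := sup (A t).
have sol0 : is_solution D 0 (fun=> 0).
  split; [exact: cst_continuous|by []|move=> t _].
  by exists 0; rewrite ?linear0.
have A0 t : A t !=set0.
  exists (`|0 : 'cV[R]_m| * tent t 0); exists 0, (fun=> 0), 0.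
  by rewrite normr0.
have Aub t : ubound (A t) M.
  move=> _ [phi [X [s [sX phi1 s0 ->]]]]; rewrite -[leRHS]mulr1.
  by apply: ler_pM => //; exact: MP sX phi1 s s0.
have cA t phi X s : is_solution D phi X -> `|phi| <= 1 -> 0 <= s ->
    `|X s| * tent t s <= c t.
  move=> sX phi1 s0; apply: ub_le_sup; first by exists M; exact: Aub.
  by exists phi, X, s.
(* Each product is [M]-Lipschitz in [t], hence so is the supremum. *)
have c_lip t u : c t <= c u + M * `|t - u|.
  apply: ge_sup => // _ [phi [X [s [sX phi1 s0 ->]]]].
  have := cA u _ _ _ sX phi1 s0.
  have : tent t s <= tent u s + `|t - u|.
    rewrite -lerBlDl; apply: le_trans (ler_norm _) _.
    apply: le_trans (max_lip _ _ _) _; rewrite opprD addrACA subrr add0r opprK.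
    rewrite addrC; apply: le_trans (ler_dist_dist _ _) _.
    by rewrite opprB addrA subrK distrC.
  have := MP _ _ sX phi1 s s0; have := normr_ge0 (X s).
  have := normr_ge0 (t - u); have := tent0 u s; nra.
have c0 t : 0 <= c t.
  by apply: le_trans (cA t _ _ 0 sol0 _ (lexx 0)); rewrite normr0 ?mul0r.
exists c; split => //.
- apply: continuous_subspaceT => t; apply/cvgrPdist_le => e e0.
  have eM : 0 < e / M by rewrite divr_gt0.
  apply/nbhs_ballP; exists (e / M) => //= u.
  rewrite /ball /= ltr_pdivlMr// mulrC => /ltW tu.
  have := c_lip t u; have := c_lip u t; rewrite (distrC u) => h1 h2.
  by rewrite ler_norml; lra.
- apply/cvgr0Pnorm_le => e e0; have [T T0 TP] := small e e0.
  near=> t; rewrite ger0_norm//; apply: ge_sup => //.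
  move=> _ [phi [X [s [sX phi1 s0 ->]]]].
  (* Late [s] have a small solution value; earlier [s] lie outside the tent once [t >= T + 1]. *)
  have [Ts|sT] := leP T s.
    rewrite -[leRHS]mulr1; apply: ler_pM => //; exact: TP sX phi1 s Ts.
  rewrite /tent max_r; first by rewrite mulr0 ltW.
  rewrite subr_le0.
  have tT : T + 1 <= t by near: t; apply: nbhs_pinfty_ge; exact: num_real.
  by apply: le_trans (ler_norm _); lra.
- move=> phi Dphi X sX t t0.
  (* Scaling by any positive [a] above the norm of [phi] also covers [phi = 0], by taking [a]
     arbitrarily small. *)
  have key (a : R) : 0 < a -> `|phi| <= a -> `|X t| <= c t * a.
    move=> a0 phia; have := cA t _ _ t (is_solutionZ a^-1 sX) _ t0.
    rewrite /tent subrr normr0 subr0 max_l// mulr1 !normrZ.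
    rewrite gtr0_norm ?invr_gt0// !ler_pdivrMl// mulr1 mulrC.
    by apply.
  have [phi0|phi0] := leP `|phi| 0; last exact: key.
  apply/ler_addgt0Pr => e e0.
  have c10 : 0 < c t + 1 by rewrite ltr_wpDl.
  apply: le_trans (key (e / (c t + 1)) _ _) _.
  + by rewrite divr_gt0.
  + by apply: le_trans phi0 _; rewrite divr_ge0// ltW.
  + apply: (@le_trans _ _ e); last by rewrite lerDr mulr_ge0.
    by rewrite mulrC -mulrA ler_piMr ?ltW// ltr_pdivrMl// mulr1 ltrDl.
Unshelve. all: by end_near. Qed.

End to_stable.
End stability.

Theorem theorem3p9 (R : realType) (m : nat)
    (D : {linear BU R m -> 'cV[R]_m})
    (D1 : continuous D)
    (D2 : co_continuous_on_balls D)
    (D3 : atomic0 D)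
    (nu : 'M[bcharge R]_m)
    (nu_regular : forall i j, regular_charge (nu i j))
    (nu_atom0 : forall i j, total_var (nu i j) [set hl0 R] = 0%E)
    (D_form : forall x : BU R m, D x = x (hl0 R) - mx_integral nu x) :
  stable D <->
  (forall r : R, 0 < r -> forall x : nat -> BU R m,
     (forall n, `|Dhat D1 (x n)| <= r) ->
     dist_co (Dhat D1 (x n)) 0 @[n --> \oo] --> (0 : R) ->
     x n (hl0 R) @[n --> \oo] --> (0 : 'cV[R]_m)).
Proof.
split; last exact: sequential_inverse_continuity_stable.
move=> [c [_ c0 cvgc cb]].
exact: (stable_sequential_inverse_continuity nu_atom0 D_form c0 cb cvgc).
Qed.
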